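(* Let $\mathfrak g^{\mathbb C}$ be a finite-dimensional complex Lie algebra and $g^{\mathbb C}$ a holomorphic inner product on $\mathfrak g^{\mathbb C}$. Let $\mathfrak g\subset\mathfrak g^{\mathbb C}$ be a real form (of Lie algebras) which is a real slice of $(\mathfrak g^{\mathbb C},g^{\mathbb C})$. Assume there exists a compact real form $\mathfrak u\subset \mathfrak g^{\mathbb C}$ (with respect to $g^{\mathbb C}$) which is also a real Lie subalgebra. Let $\sigma$ be the conjugation map of $\mathfrak g^{\mathbb C}$ with fixed point set $\mathfrak g$. Then there exists an automorphism $\phi\in \mathrm{Aut}(\mathfrak g^{\mathbb C})\cap O(n,\mathbb C)$ such that $\sigma(\phi(\mathfrak u))\subset\phi(\mathfrak u)$.
   Context: A holomorphic inner product on a complex vector space is a symmetric non-degenerate complex bilinear form. Let $n=\dim_{\mathbb C}\mathfrak g^{\mathbb C}$; $O(n,\mathbb C)$ denotes the group of complex linear isometries of $(\mathfrak g^{\mathbb C},g^{\mathbb C})$, and $\mathrm{Aut}(\mathfrak g^{\mathbb C})$ the group of complex Lie algebra automorphisms. A real form of the vector space $\mathfrak g^{\mathbb C}$ is a real subspace $V$ with $\mathfrak g^{\mathbb C}=V\oplus iV$; its conjugation map is the conjugate-linear involution with fixed point set $V$. $V$ is a real slice if $g^{\mathbb C}|_V$ is real valued and non-degenerate. A compact real form of $(\mathfrak g^{\mathbb C},g^{\mathbb C})$ is a real form $W$ (as a vector space) such that $g^{\mathbb C}|_W$ is real valued and positive definite. *)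

(* Defs.v *)
From mathcomp Require Export all_boot all_order all_algebra.
From mathcomp Require Export complex.
From mathcomp Require Export boolp classical_sets reals.

Import Order.TTheory GRing.Theory Num.Theory.

#[export] Set Implicit Arguments.
#[export] Unset Strict Implicit.
#[export] Unset Printing Implicit Defensive.

Local Open Scope classical_set_scope.
Local Open Scope ring_scope.
Local Open Scope complex_scope.

Record is_lie_bracket (R : realType) (V : vectType R[i])
    (br : {bilinear V -> V -> V}) : Prop := IsLieBracket {
  lie_alternating : forall x, br x x = 0;
  lie_jacobi : forall x y z,
    br x (br y z) + br y (br z x) + br z (br x y) = 0 }.

Record real_subspace (R : realType) (V : vectType R[i]) (W : set V) : Prop :=
  RealSubspace {
    real_subspace0 : W 0;
    real_subspaceD : forall x y, W x -> W y -> W (x + y);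
    real_subspaceZ : forall (a : R) x, W x -> W (a%:C *: x) }.

Record real_form (R : realType) (V : vectType R[i]) (W : set V) : Prop :=
  RealForm {
    real_form_subspace : real_subspace W;
    real_form_sum :
      [set x + y | x in W & y in [set 'i *: z | z in W]] = [set: V];
    real_form_direct : W `&` [set 'i *: z | z in W] = [set 0] }.

Record real_lie_subalgebra (R : realType) (V : vectType R[i])
    (br : {bilinear V -> V -> V}) (W : set V) : Prop := RealLieSubalgebra {
  real_lie_subalgebra_subspace : real_subspace W;
  real_lie_subalgebra_bracket : forall x y, W x -> W y -> W (br x y) }.

Definition lie_real_form (R : realType) (V : vectType R[i])
    (br : {bilinear V -> V -> V}) (W : set V) : Prop :=
  real_form W /\ real_lie_subalgebra br W.

Definition real_valued_on (R : realType) (V : vectType R[i])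
    (g : {symmetric V}) (W : set V) : Prop :=
  forall x y, W x -> W y -> g x y \is Num.real.

Record real_slice (R : realType) (V : vectType R[i])
    (g : {symmetric V}) (W : set V) : Prop := RealSlice {
  real_slice_form : real_form W;
  real_slice_real : real_valued_on g W;
  real_slice_nondegenerate :
    forall x, W x -> (forall y, W y -> g x y = 0) -> x = 0 }.

(* In R[i], 0 < z means that z is real and positive. *)
Record compact_real_form (R : realType) (V : vectType R[i])
    (g : {symmetric V}) (W : set V) : Prop := CompactRealForm {
  compact_real_form_form : real_form W;
  compact_real_form_real : real_valued_on g W;
  compact_real_form_posdef : forall x, W x -> x != 0 -> 0 < g x x }.

Record conjugation_map (R : realType) (V : vectType R[i])
    (W : set V) (sigma : V -> V) : Prop := ConjugationMap {
  conjugation_map_semilinear :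
    forall (a : R[i]) x y, sigma (a *: x + y) = a^* *: sigma x + sigma y;
  conjugation_map_involutive : involutive sigma;
  conjugation_map_fixed : [set x | sigma x = x] = W }.

Definition lie_automorphisms (R : realType) (V : vectType R[i])
    (br : {bilinear V -> V -> V}) : set 'End(V) :=
  [set f : 'End(V) | bijective f /\ {morph f : x y / br x y}].

Definition linear_isometries (R : realType) (V : vectType R[i])
    (g : {symmetric V}) : set 'End(V) :=
  [set f : 'End(V) | bijective f /\ forall x y, g (f x) (f y) = g x y].

(* Main.v *)
(* Let tau be the conjugation fixing u.  Then N := sigma o tau is a complex
   linear Lie automorphism preserving g, and it is self-adjoint for the positive
   definite Hermitian form g x (tau y); hence it is diagonalizable with real
   nonzero eigenvalues.  Put phi := |N|^(1/2) and S := sign N.  As products of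
   eigenvalues govern br and g, phi is again an automorphism and an isometry.
   Both sigma and tau exchange the a- and a^-1-eigenspaces of N, so tau commutes
   with S and sigma o phi o tau = phi o S; thus sigma (phi x) = phi (S x), with
   S x in u, for every x in u. *)
Require Import Defs.
From HB Require Import structures.

Import Order.TTheory GRing.Theory Num.Theory.
Local Open Scope classical_set_scope.
Local Open Scope ring_scope.
Local Open Scope complex_scope.

(** * Semisimple endomorphisms and their functional calculus *)

Lemma horner_mx_undup (F : fieldType) (n : nat) (A : 'M[F]_n.+1) (rs : seq F)
    (ss : forall a (v : 'rV_n.+1), v *m (A - a%:M) *m (A - a%:M) = 0 ->
       v *m (A - a%:M) = 0) (q : {poly F}) (v : 'rV_n.+1) :
  v *m horner_mx A (q * \prod_(r <- rs) ('X - r%:P)) = 0 ->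
  v *m horner_mx A (q * \prod_(r <- undup rs) ('X - r%:P)) = 0.
Proof.
elim: rs q => [//|a rs IHrs] q /=; rewrite big_cons.
case: ifPn => [a_rs|_]; last first.
  by rewrite big_cons !mulrA => /IHrs.
move=> vq0; apply: IHrs; move: vq0.
rewrite (big_rem a a_rs) /=; set Q := \prod_(r <- _) _.
(* The repeated factor is moved to the end of the product, where [ss] drops one of its two
   copies. *)
rewrite (_ : q * (_ * (_ * Q)) = q * Q * ('X - a%:P) * ('X - a%:P)); last first.
  by rewrite -!mulrA [Q * _]mulrC -!mulrA.
rewrite (_ : q * (_ * Q) = (q * Q) * ('X - a%:P)); last first.
  by rewrite -!mulrA [Q * _]mulrC.
rewrite !rmorphM rmorphB /= horner_mx_X horner_mx_C -!mulmxE !mulmxA.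
exact: ss.
Qed.

(** The minimal polynomial splits, and by [ss] it still annihilates [A] once repeated roots are
    removed; so [A] is killed by a product of distinct linear factors. *)
Lemma semisimple_diagonalizable (F : closedFieldType) (n : nat) (A : 'M[F]_n)
    (ss : forall a (v : 'rV_n), v *m (A - a%:M) *m (A - a%:M) = 0 ->
       v *m (A - a%:M) = 0) :
  diagonalizable A.
Proof.
case: n A ss => [|n] A ss; first by rewrite [A]thinmx0; exact: diagonalizable0.
have [rs prs] := closed_field_poly_normal (mxminpoly A).
apply/diagonalizableP; exists (undup rs); first exact: undup_uniq.
apply: mxminpoly_min; apply/row_matrixP => i.
rewrite row0 rowE -[X in horner_mx A X]mul1r.
apply: horner_mx_undup => //; rewrite mul1r.
have := mx_root_minpoly A; rewrite prs (monicP (mxminpoly_monic A)) scale1r => ->.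
by rewrite mulmx0.
Qed.

Section Semisimple.
Import passmx.
Context (F : closedFieldType) (V : vectType F) (f : 'End(V)).
Hypothesis ss : forall a x,
  f (f x - a *: x) = a *: (f x - a *: x) -> f x = a *: x.

Let e := vbasis {:V}.
Let A := mxof e e f.
Let eP : basis_of {:V} e := vbasisP _.

Let rVof_eigen a x : rVof e x *m (A - a%:M) = rVof e (f x - a *: x).
Proof. by rewrite mulmxBr -rVof_app ?mul_mx_scalar ?linearB /= ?[rVof e (_ *: _)]linearZ. Qed.

Lemma semisimple_mxof :
  exists2 P, P \in unitmx & exists d, A = invmx P *m diag_mx d *m P.
Proof.
have [P Pu /(diagonalizable_forLR Pu)[d ->]] : diagonalizable A.
  apply: semisimple_diagonalizable => a v.
  rewrite -[v](vecofK eP) !rVof_eigen => /eqP.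
  rewrite rVof_eq0 // subr_eq0 => /eqP /ss ->.
  by rewrite subrr linear0.
by exists P => //; exists d; rewrite mxpoly.conjVmx.
Qed.

(** This is h(f): [h] is applied to the diagonal entries in an eigenbasis. Eigenvectors span, so the
    stated property determines [phi]. *)
Lemma semisimple_calculus (h : F -> F) :
  exists phi : 'End(V), forall a x, f x = a *: x -> phi x = h a *: x.
Proof.
have [P Pu [d Ad]] := semisimple_mxof.
pose B := invmx P *m diag_mx (map_mx h d) *m P.
exists (hommx e e B) => a x fx.
rewrite hommxE // -[RHS](rVofK eP); congr vecof.
rewrite [in RHS]linearZ /= /B !mulmxA.
have: rVof e x *m A = a *: rVof e x by rewrite -rVof_app // fx linearZ.
rewrite Ad !mulmxA.
set w := rVof e x *m invmx P => /(congr1 (fun v => v *m invmx P)).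
rewrite /= mulmxK // -scalemxAl -/w => wd.
rewrite -[rVof e x](mulmxKV Pu) -/w scalemxAl; congr (_ *m P); clearbody w.
(* In each coordinate of the eigenbasis, either [w] vanishes or the diagonal entry equals [a]. *)
apply/rowP => i; move/rowP/(_ i): wd.
rewrite !mul_mx_diag !mxE mulrC => wd.
have [->|wi0] := eqVneq (w 0 i) 0; first by rewrite mul0r mulr0.
by rewrite mulrC (mulIf wi0 wd).
Qed.

(** Reduces additive properties to eigenvectors, which span. Closure under scaling need not be
    assumed, since multiples of eigenvectors are again eigenvectors. *)
Lemma semisimple_ind (P : V -> Prop) :
    P 0 -> (forall x y, P x -> P y -> P (x + y)) ->
    (forall a x, f x = a *: x -> P x) ->
  forall x, P x.
Proof.
move=> P0 PD Pf x.
have [Q Qu [d Ad]] := semisimple_mxof.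
rewrite -[x](rVofK eP) -[rVof e x](mulmxKV Qu) mulmx_sum_row linear_sum /=.
apply: (big_ind P) => // i _; apply: (Pf (d 0 i)).
have fQ : f (vecof e (row i Q)) = d 0 i *: vecof e (row i Q).
  rewrite (hom_vecof e eP) -/A Ad !mulmxA -row_mul mulmxV // row1.
  by rewrite -rowE row_diag_mx -scalemxAl -rowE linearZ.
by rewrite linearZ /= linearZ /= fQ !scalerA mulrC.
Qed.

End Semisimple.

(** * Real forms and their conjugation maps *)

Lemma real_subspace_real (R : realType) (V : vectType R[i]) (W : set V)
    (a : R[i]) (x : V) :
  real_subspace W -> a \is Num.real -> W x -> W (a *: x).
Proof.
by move=> WS /RRe_real <- Wx; exact: real_subspaceZ.
Qed.

Section Semilinear.
Context (R : realType) (V U : lmodType R[i]) (s : V -> U).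
Hypothesis sP : forall (a : R[i]) x y, s (a *: x + y) = a^* *: s x + s y.

Lemma semilinear_add x y : s (x + y) = s x + s y.
Proof. by have := sP 1 x y; rewrite rmorph1 !scale1r. Qed.

Lemma semilinear_0 : s 0 = 0.
Proof. by apply: (addrI (s 0)); rewrite -semilinear_add !addr0. Qed.

Lemma semilinear_scale a x : s (a *: x) = a^* *: s x.
Proof. by have := sP a x 0; rewrite semilinear_0 !addr0. Qed.

Lemma semilinear_sub x y : s (x - y) = s x - s y.
Proof.
by rewrite semilinear_add -scaleN1r semilinear_scale rmorphN1 scaleN1r.
Qed.

End Semilinear.

Section RealForm.
Context (R : realType) (V : vectType R[i]) (W : set V).
Hypothesis WP : real_form W.
Let WS := real_form_subspace WP.

Let WB x y : W x -> W y -> W (x - y).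
Proof.
move=> Wx Wy; apply: (real_subspaceD WS) => //; rewrite -scaleN1r.
by apply: real_subspace_real; rewrite // realN real1.
Qed.

Lemma real_form_inj a b c d : W a -> W b -> W c -> W d ->
  a + 'i *: b = c + 'i *: d -> a = c /\ b = d.
Proof.
move=> Wa Wb Wc Wd E.
have acE : a - c = 'i *: (d - b).
  rewrite scalerBr -[a](addrK ('i *: b)) E.
  by rewrite [c + _]addrC [_ + c - _]addrAC addrK.
have : (W `&` [set 'i *: z | z in W]) (a - c).
  by split; [exact: WB | exists (d - b); [exact: WB | rewrite acE]].
rewrite (real_form_direct WP) /= => /eqP ac0; split.
  by apply/eqP; rewrite -subr_eq0.
move: ac0; rewrite acE scaler_eq0 (negPf (neq0Ci _)) subr_eq0 /=.
by move/eqP.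
Qed.

Lemma real_form_dec x : exists ab : V * V,
  [/\ W ab.1, W ab.2 & x = ab.1 + 'i *: ab.2].
Proof.
have : [set: V] x by [].
rewrite -(real_form_sum WP) => -[a Wa [_ [b Wb <-] <-]].
by exists (a, b).
Qed.

Lemma real_form_conjugation : exists s : V -> V, conjugation_map W s.
Proof.
have [p pP] := choice real_form_dec.
pose s x := (p x).1 - 'i *: (p x).2.
(* By uniqueness, [s] can be computed from any decomposition, not only from the chosen one. *)
have pE x a b : W a -> W b -> x = a + 'i *: b -> s x = a - 'i *: b.
  move=> Wa Wb; have [W1 W2 {1}->] := pP x.
  by move=> /(real_form_inj W1 W2 Wa Wb)[<- <-].
have WN x : W x -> W (- x).
  by move=> Wx; rewrite -sub0r; apply: WB => //; exact: (real_subspace0 WS).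
exists s; split.
- move=> a x y; rewrite [s x]/s [s y]/s.
  have [W1 W2 xE] := pP x; have [W3 W4 yE] := pP y.
  rewrite {1}xE {1}yE.
  move: (p x).1 (p x).2 (p y).1 (p y).2 W1 W2 W3 W4 => x1 x2 y1 y2 W1 W2 W3 W4.
  have ar : 'Re a \is Num.real by exact: Creal_Re.
  have ai : 'Im a \is Num.real by exact: Creal_Im.
  rewrite [a]Crect; move: ('Re a) ('Im a) ar ai => r i ar ai.
  have rZ c z : c \is Num.real -> W z -> W (c *: z).
    by move=> cr; exact: real_subspace_real.
  have iiC : 'i * i * 'i = - i by rewrite mulrAC -expr2 sqrCi mulN1r.
  (* The witnesses are the components of (r + 'i i)(x1 + 'i x2) + (y1 + 'i y2), where [i] is a real
     scalar and ['i] the imaginary unit. *)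
  rewrite (pE _ (r *: x1 - i *: x2 + y1) (r *: x2 + i *: x1 + y2)).
  + rewrite !(rmorphD, rmorphM) /= conjCi !conj_Creal // mulNr.
    rewrite !(scalerDl, scalerDr, scalerN, scaleNr) !scalerA !opprD !opprK.
    rewrite iiC scaleNr ['i * r]mulrC.
    by rewrite [LHS](AC (3*3) ((1*4)*(5*2)*(3*6)))%AC.
  + by apply: (real_subspaceD WS) => //; apply: WB; exact: rZ.
  + by do 2!apply: (real_subspaceD WS) => //; exact: rZ.
  + rewrite !(scalerDl, scalerDr, scalerN, scaleNr) !scalerA.
    rewrite iiC scaleNr ['i * r]mulrC.
    by rewrite [LHS](AC (2*2*2) ((1*4*5)*(2*3*6)))%AC.
- move=> x; have [W1 W2 xE] := pP x.
  by rewrite (pE (s x) (p x).1 (- (p x).2)) ?scalerN ?opprK //; exact: WN.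
- apply/seteqP; split => x /=.
    (* A fixed point has imaginary component b with -b = b, hence b = 0. *)
    have [W1 W2 xE] := pP x; rewrite {2}xE /s -scalerN => E.
    have [_ /eqP] := real_form_inj W1 (WN _ W2) W1 W2 E.
    rewrite -subr_eq0 -opprD oppr_eq0 -mulr2n -scaler_nat scaler_eq0.
    by rewrite pnatr_eq0 /= => /eqP b0; rewrite xE b0 scaler0 addr0.
  move=> Wx; rewrite (pE x x 0) ?scaler0 ?subr0 ?addr0 //.
  exact: (real_subspace0 WS).
Qed.
End RealForm.

Section Conjugation.
Context (R : realType) (V : vectType R[i]) (W : set V) (s : V -> V).
Hypothesis sP : conjugation_map W s.
Let sS := conjugation_map_semilinear sP.

Lemma conjugation_mapK : involutive s.
Proof. exact: conjugation_map_involutive sP. Qed.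

Lemma conjugation_map_fix x : W x <-> s x = x.
Proof. by rewrite -(conjugation_map_fixed sP). Qed.

(** The components are (x + s x)/2 and (x - s x)/(2 'i), both fixed by [s]. *)
Lemma conjugation_map_dec x :
  exists a b, [/\ W a, W b & x = a + 'i *: b].
Proof.
exists (2^-1 *: (x + s x)), ((2^-1 * - 'i) *: (x - s x)); split.
- apply/conjugation_map_fix.
  rewrite (semilinear_scale sS) (semilinear_add sS) conjugation_mapK addrC.
  by rewrite fmorphV /= rmorph_nat.
- apply/conjugation_map_fix.
  rewrite (semilinear_scale sS) (semilinear_sub sS) conjugation_mapK.
  rewrite rmorphM rmorphN /= conjCi opprK fmorphV /= rmorph_nat.
  by rewrite -[RHS]opprK -scaleNr -scalerN opprB mulrN opprK.
rewrite scalerA mulrCA mulrN -expr2 sqrCi opprK mulr1 -scalerDr.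
rewrite addrACA subrr addr0 -mulr2n -[x *+ 2]scaler_nat scalerA.
by rewrite mulVf ?scale1r // pnatr_eq0.
Qed.

(** Both sides are conjugate-linear in each argument, so agreement on [W], which spans over the
    complex numbers, suffices. Later [t] is [s] itself for the bracket and complex conjugation for
    [g]. *)
Lemma conjugation_map_bilinear (U : lmodType R[i]) (t : U -> U)
    (B : V -> V -> U) :
    (forall (a : R[i]) x y, t (a *: x + y) = a^* *: t x + t y) ->
    (forall a x y z, B (a *: x + y) z = a *: B x z + B y z) ->
    (forall a x y z, B z (a *: x + y) = a *: B z x + B z y) ->
    (forall x y, W x -> W y -> t (B x y) = B x y) ->
  forall x y, B (s x) (s y) = t (B x y).
Proof.
move=> tS Bl Br BW x y.
have [a [b [Wa Wb ->]]] := conjugation_map_dec x.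
have [c [d [Wc Wd ->]]] := conjugation_map_dec y.
rewrite ![_ + 'i *: _]addrC !sS conjCi.
have [/conjugation_map_fix -> /conjugation_map_fix ->] := (Wa, Wb).
have [/conjugation_map_fix -> /conjugation_map_fix ->] := (Wc, Wd).
by rewrite !(Bl, Br) !tS !BW // conjCi.
Qed.

End Conjugation.

Lemma linear_endE (F : fieldType) (V : vectType F) (f : V -> V)
    (fl : forall (a : F) x y, f (a *: x + y) = a *: f x + f y) :
  exists N : 'End(V), N =1 f.
Proof.
pose L : {linear V -> V} := HB.pack f (GRing.isLinear.Build F V V *:%R f fl).
by exists (linfun L) => x; rewrite lfunE.
Qed.

(** * The product of the two conjugations *)

Section ConjugationPair.
Context (R : realType) (V : vectType R[i]) (br : {bilinear V -> V -> V}).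
Context (g : {symmetric V}) (g0 u : set V) (sigma tau : V -> V).
Hypothesis g0_lie : real_lie_subalgebra br g0.
Hypothesis u_lie : real_lie_subalgebra br u.
Hypothesis g0_real : real_valued_on g g0.
Hypothesis u_compact : compact_real_form g u.
Hypothesis sigmaP : conjugation_map g0 sigma.
Hypothesis tauP : conjugation_map u tau.

Let sK := conjugation_mapK sigmaP.
Let tK := conjugation_mapK tauP.
Let sS := conjugation_map_semilinear sigmaP.
Let tS := conjugation_map_semilinear tauP.

Lemma conjugation_map_bracket (W : set V) (s : V -> V) :
    real_lie_subalgebra br W -> conjugation_map W s ->
  forall x y, br (s x) (s y) = s (br x y).
Proof.
move=> WL sP; apply: (conjugation_map_bilinear sP).
- exact: conjugation_map_semilinear sP.
- by move=> a x y z; rewrite linearPl.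
- by move=> a x y z; rewrite linearPr.
- move=> x y Wx Wy; apply/(conjugation_map_fix sP).
  exact: (real_lie_subalgebra_bracket WL).
Qed.

Lemma conjugation_map_form (W : set V) (s : V -> V) :
    real_valued_on g W -> conjugation_map W s ->
  forall x y, g (s x) (s y) = ((g x y)^*)%R.
Proof.
move=> gW sP.
apply: (conjugation_map_bilinear (U := R[i]^o) sP (t := Num.conj)).
- by move=> a x y; rewrite rmorphD rmorphM.
- by move=> a x y z; rewrite linearPl.
- by move=> a x y z; rewrite linearPr.
- by move=> x y Wx Wy; rewrite conj_Creal // gW.
Qed.

(** For x = a + 'i b with a, b in [u], the cross terms cancel by symmetry and g a a + g b b
    remains. *)
Lemma compact_form_gt0 x : x != 0 -> 0 < g x (tau x).
Proof.
have gt0 := compact_real_form_posdef u_compact.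
have ge0 a : u a -> 0 <= g a a.
  by move=> ua; have [->|/(gt0 _ ua)/ltW //] := eqVneq a 0; rewrite linear0r.
have [a [b [ua ub ->]]] := conjugation_map_dec tauP x.
have gE : g (a + 'i *: b) (tau (a + 'i *: b)) = g a a + g b b.
  rewrite [a + _]addrC tS conjCi !(linearDl, linearDr).
  rewrite !(linearZl_LR, linearZr_LR) /=.
  move: (ua) (ub) => /(conjugation_map_fix tauP) -> /(conjugation_map_fix tauP) ->.
  rewrite [g b a]hermC /= mul1r mulrA mulrN -expr2 sqrCi opprK mul1r mulNr.
  by rewrite addrA addrK addrC.
rewrite gE; have [->|a0 _] := eqVneq a 0.
  rewrite add0r scaler_eq0 (negPf (neq0Ci _)) /= => b0.
  by rewrite linear0r add0r gt0.
by rewrite ltr_pwDl ?gt0 ?ge0.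
Qed.

Context (N : 'End(V)).
Hypothesis NE : forall x, N x = sigma (tau x).

Let t_bracket := conjugation_map_bracket u_lie tauP.
Let s_bracket := conjugation_map_bracket g0_lie sigmaP.
Let t_form := conjugation_map_form (compact_real_form_real u_compact) tauP.
Let s_form := conjugation_map_form g0_real sigmaP.

Lemma conjugation_pair_bracket x y : N (br x y) = br (N x) (N y).
Proof. by rewrite !NE s_bracket t_bracket. Qed.

Lemma conjugation_pair_form x y : g (N x) (N y) = g x y.
Proof. by rewrite !NE s_form t_form conjCK. Qed.

(** Pulling [sigma] out on the left and [tau] out on the right turns both sides into the conjugate
    of g (tau x) (N y). *)
Lemma conjugation_pair_selfadjoint x y : g (N x) (tau y) = g x (tau (N y)).
Proof.
by rewrite -[in LHS](sK (tau y)) -[in RHS](tK x) t_form !NE s_form.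
Qed.

Lemma conjugation_pair_eigen_real a x :
  x != 0 -> N x = a *: x -> (a^*)%R = a.
Proof.
move=> x0 Nx; have := conjugation_pair_selfadjoint x x.
rewrite Nx (semilinear_scale tS) linearZl_LR linearZr_LR /=.
by move/(mulIf (lt0r_neq0 (compact_form_gt0 x0))) => <-.
Qed.

Lemma conjugation_pair_eigen_neq0 a x : x != 0 -> N x = a *: x -> a != 0.
Proof.
move=> x0 Nx; apply: contraNneq x0 => a0.
rewrite -[x]tK -[tau x]sK -NE Nx a0 scale0r.
by rewrite (semilinear_0 sS) (semilinear_0 tS).
Qed.

(** If y = N x - a x were nonzero, it would be an eigenvector, so a would be real; self-adjointness
    would then give g y (tau y) = g x (tau (N y - a y)) = 0, against positivity. *)
Lemma conjugation_pair_semisimple a x :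
  N (N x - a *: x) = a *: (N x - a *: x) -> N x = a *: x.
Proof.
set y := N x - a *: x => Ny.
apply/eqP; rewrite -subr_eq0 -/y; apply/negPn/negP => y0.
have ar := conjugation_pair_eigen_real y0 Ny.
have := compact_form_gt0 y0.
rewrite {1}/y linearBl linearZl_LR /= conjugation_pair_selfadjoint Ny.
by rewrite (semilinear_scale tS) ar linearZr_LR /= subrr ltxx.
Qed.

(** Applying [sigma] to N x = a x gives tau x = a sigma x, as a is real. Hence [tau x] is an
    eigenvector of [N] for a^-1. *)
Lemma conjugation_pair_eigen_inv a x :
  x != 0 -> N x = a *: x -> sigma x = a^-1 *: tau x.
Proof.
move=> x0 Nx; have a0 := conjugation_pair_eigen_neq0 x0 Nx.
have : sigma (N x) = (a^*)%R *: sigma x by rewrite Nx (semilinear_scale sS).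
rewrite (conjugation_pair_eigen_real x0 Nx) NE sK => ->.
by rewrite scalerA mulVf ?scale1r.
Qed.

Let Nind := semisimple_ind conjugation_pair_semisimple.

Lemma conjugation_pair_automorphism :
  exists2 phi : 'End(V), (lie_automorphisms br `&` linear_isometries g) phi &
    sigma @` (phi @` u) `<=` phi @` u.
Proof.
(* The modulus makes [h] multiplicative on all complex numbers, since [sqrtC] is applied to
   nonnegative arguments only. *)
pose h (a : R[i]) : R[i] := sqrtC `|a|.
have hM a b : h (a * b) = h a * h b by rewrite /h normrM sqrtCM ?nnegrE.
have [phi phiE] := semisimple_calculus conjugation_pair_semisimple h.
have [S SE] :=
  semisimple_calculus conjugation_pair_semisimple (fun a => a / `|a|).
have phi_br x y : phi (br x y) = br (phi x) (phi y).
  elim/Nind: x => [|x1 x2 h1 h2|a x Nx].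
  - by rewrite !(linear0, linear0l).
  - by rewrite !(linearD, linearDl) /= h1 h2.
  elim/Nind: y => [|x1 x2 h1 h2|b y Ny].
  - by rewrite !(linear0, linear0r).
  - by rewrite !(linearD, linearDr) /= h1 h2.
  (* The bracket satisfies the eigenvector equation for a b, even when it is zero. *)
  rewrite (phiE _ _ Nx) (phiE _ _ Ny) (phiE (a * b)).
    by rewrite linearZl_LR linearZr_LR /= scalerA hM.
  by rewrite conjugation_pair_bracket Nx Ny linearZl_LR linearZr_LR /= scalerA.
have phi_g x y : g (phi x) (phi y) = g x y.
  elim/Nind: x => [|x1 x2 h1 h2|a x Nx].
  - by rewrite !(linear0, linear0l, linear0r).
  - by rewrite linearD !linearDl /= h1 h2.
  elim/Nind: y => [|x1 x2 h1 h2|b y Ny].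
  - by rewrite !(linear0, linear0l, linear0r).
  - by rewrite linearD !linearDr /= h1 h2.
  rewrite (phiE _ _ Nx) (phiE _ _ Ny) linearZl_LR linearZr_LR /= mulrA -hM.
  have := conjugation_pair_form x y.
  rewrite Nx Ny linearZl_LR linearZr_LR /= mulrA.
  (* Eigenvectors pair to a nonzero value only if a b = 1, and then h (a b) = 1. *)
  have [->|gxy] := eqVneq (g x y) 0; first by rewrite !mulr0.
  rewrite -[in RHS](mul1r (g x y)) => /(mulIf gxy) ->.
  by rewrite /h normr1 sqrtC1 mul1r.
(* If phi x = 0, then g x (tau x) = g (phi x) (phi (tau x)) = 0, so x = 0 by positivity. *)
have phi_inj : lker phi == 0%VS.
  rewrite -subv0; apply/subvP => x; rewrite memv_ker memv0 => /eqP px.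
  apply/negPn/negP => /compact_form_gt0.
  by rewrite -phi_g px linear0l ltxx.
have tauS x : tau (S x) = S (tau x).
  elim/Nind: x => [|x1 x2 h1 h2|a x Nx].
  - by rewrite (semilinear_0 tS) !linear0 (semilinear_0 tS).
  - by rewrite !(linearD, semilinear_add tS) /= h1 h2.
  have [->|x0] := eqVneq x 0.
    by rewrite (semilinear_0 tS) !linear0 (semilinear_0 tS).
  have Ntx : N (tau x) = a^-1 *: tau x.
    by rewrite NE tK (conjugation_pair_eigen_inv x0 Nx).
  have ar := conjugation_pair_eigen_real x0 Nx.
  have a0 := conjugation_pair_eigen_neq0 x0 Nx.
  rewrite (SE _ _ Nx) (SE _ _ Ntx) (semilinear_scale tS); congr (_ *: _).
  (* The signs of a and a^-1 agree: this amounts to a^2 = |a|^2 for real a. *)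
  rewrite rmorphM fmorphV /= conj_normC ar normfV invrK.
  apply/eqP; rewrite [_^-1 * _]mulrC eqr_div ?normr_eq0 // -!expr2.
  by rewrite real_normK // CrealE ar.
have sigma_phi x : sigma (phi (tau x)) = phi (S x).
  elim/Nind: x => [|x1 x2 h1 h2|a x Nx].
  - by rewrite (semilinear_0 tS) !linear0 (semilinear_0 sS).
  - by rewrite !(linearD, semilinear_add tS, semilinear_add sS) /= h1 h2.
  have [->|x0] := eqVneq x 0.
    by rewrite (semilinear_0 tS) !linear0 (semilinear_0 sS).
  have Ntx : N (tau x) = a^-1 *: tau x.
    by rewrite NE tK (conjugation_pair_eigen_inv x0 Nx).
  have a0 := conjugation_pair_eigen_neq0 x0 Nx.
  rewrite (SE _ _ Nx) (phiE _ _ Ntx) (semilinear_scale sS) -NE Nx.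
  rewrite [phi (_ *: _)]linearZ /= (phiE _ _ Nx) !scalerA; congr (_ *: _).
  (* What remains is (h a)^-1 a = (a / |a|) h a, which holds because |a| = (h a)^2. *)
  have h0 : h a != 0 by rewrite /h sqrtC_eq0 normr_eq0.
  have -> : h a^-1 = (h a)^-1.
    apply: (mulfI h0); rewrite -hM !mulfV //.
    by rewrite /h normr1 sqrtC1.
  have -> : `|a| = h a ^+ 2 by rewrite sqrtCK.
  rewrite conj_Creal; last by rewrite realV ger0_real // sqrtC_ge0.
  by rewrite expr2 invfM mulrA mulfVK // mulrC.
exists phi.
  have phi_bij : bijective phi.
    by exists phi^-1%VF; [exact: lker0_lfunK | exact: lker0_lfunVK].
  by split.
move=> _ [_ [x ux <-] <-]; exists (S x); last first.
  by rewrite -sigma_phi; move/(conjugation_map_fix tauP): ux => ->.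
apply/(conjugation_map_fix tauP); rewrite tauS.
by move/(conjugation_map_fix tauP): ux => ->.
Qed.

End ConjugationPair.

Theorem corollary3p3 (R : realType) (V : vectType R[i])
    (br : {bilinear V -> V -> V}) (g : {symmetric V})
    (g0 u : set V) (sigma : V -> V)
    (Hbr : is_lie_bracket br)
    (Hg : nondegenerate g)
    (Hg0 : lie_real_form br g0)
    (Hslice : real_slice g g0)
    (Hu : compact_real_form g u)
    (Hu_lie : real_lie_subalgebra br u)
    (Hsigma : conjugation_map g0 sigma) :
  exists2 phi : 'End(V),
    (lie_automorphisms br `&` linear_isometries g) phi &
    sigma @` (phi @` u) `<=` phi @` u.
Proof.
have [tau tauP] := real_form_conjugation (compact_real_form_form Hu).
have [N NE] : exists N : 'End(V), N =1 sigma \o tau.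
  apply: linear_endE => a x y /=.
  rewrite (conjugation_map_semilinear tauP).
  by rewrite (conjugation_map_semilinear Hsigma) conjCK.
have [_ g0_lie] := Hg0.
exact: (conjugation_pair_automorphism g0_lie Hu_lie (real_slice_real Hslice)
  Hu Hsigma tauP NE).
Qed.
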